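(* Let $\tau>0$ and let $\tilde E$ be a symmetric positive definite matrix of the same size as $E=Z^TAZ$. With the setting and notation of the context (symmetric positive definite $A\in\mathbb{R}^{n\times n}$, overlapping decomposition into $N$ subdomains, near-kernel subspace $G$, local matrices $B_i=R_iAR_i^T$, coarse space $V_0=V_G+V^\tau_{geneo}$ with basis matrix $Z$), put $\tilde P_0:=Z\tilde E^{-1}Z^TA$ and define the additive Schwarz with GenEO preconditioner with inexact coarse solves $$\tilde M^{-1}_{AS,2}:=Z\tilde E^{-1}Z^T+(I-\tilde P_0)\sum_{i=1}^N R_i^T(R_iAR_i^T)^{-1}R_i\,(I-\tilde P_0^T).$$ Let $\lambda_+:=\lambda_{max}(E\tilde E^{-1})$, $\lambda_-:=\lambda_{min}(E\tilde E^{-1})$ and $\epsilon_A:=\max(|1-\lambda_-|,|1-\lambda_+|)$. Then for all $\mathbf U\in\mathbb{R}^n$ $$c_T\,a(\mathbf U,\mathbf U)\le a\big(\tilde M^{-1}_{AS,2}A\mathbf U,\mathbf U\big)\le c_R\,a(\mathbf U,\mathbf U),$$ where $$c_R=\frac{k_0(1+\epsilon_A^2)+\lambda_++\sqrt{\big(k_0(1+\epsilon_A^2)-\lambda_+\big)^2+4\lambda_+k_0\epsilon_A^2}}{2},\qquad c_T=\frac{\lambda_-}{(1+\epsilon_A\sqrt{k_0k_1\tau})^2+\lambda_-k_1\tau}.$$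
   Context: All scalar products $(\cdot,\cdot)$ are Euclidean. $A\in\mathbb{R}^{n\times n}$ is a symmetric positive definite (SPD) matrix arising from a conforming finite element discretisation of a symmetric coercive bilinear form $a$ on a domain $\Omega$; write $a(\mathbf U,\mathbf V)=(A\mathbf U,\mathbf V)$. The form is a sum over mesh elements, $a=\sum_{K} a_K$, with each $a_K$ a symmetric positive semidefinite bilinear form on $\mathbb{R}^n$. $\Omega$ is covered by $N$ overlapping subdomains $\Omega_i$, each a union of mesh elements. $R_i\in\mathbb{R}^{n_i\times n}$ is the Boolean restriction matrix selecting the $n_i$ degrees of freedom of $\Omega_i$. $D_i\in\mathbb{R}^{n_i\times n_i}$ are diagonal matrices forming a partition of unity: $\sum_{i=1}^N R_i^TD_iR_i=I$. The local Neumann matrix $A_i^{Neu}\in\mathbb{R}^{n_i\times n_i}$ is defined by $(A_i^{Neu}R_i\mathbf U,R_i\mathbf V)=\sum_{K\subset\Omega_i}a_K(\mathbf U,\mathbf V)$ for all $\mathbf U,\mathbf V\in\mathbb{R}^n$ (the right side depends only on $R_i\mathbf U,R_i\mathbf V$), and is assumed SPD. $k_0:=\max_{1\le i\le N}\#\{j : R_jAR_i^T\neq 0\}$ is the maximal number of neighbours of a subdomain (including itself). $k_1$ is the maximal multiplicity of subdomain intersections, i.e. the largest number of subdomains sharing a common mesh element. $G\subset\mathbb{R}^n$ is a given subspace (the near-kernel of $A$), $G_i:=R_iG\subset\mathbb{R}^{n_i}$, and $V_G:=\sum_{i=1}^N R_i^TD_iG_i\subset\mathbb{R}^n$. $B_i:=R_iAR_i^T$,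 and $\xi_{0i}$ is the $B_i$-orthogonal projection of $\mathbb{R}^{n_i}$ onto $G_i$. GenEO coarse space: for each $1\le j\le N$, consider the generalized eigenvalue problem of finding $(\mathbf V_{jk},\lambda_{jk})\in(\mathbb{R}^{n_j}\setminus\{0\})\times\mathbb{R}$ with $$(I-\xi_{0j}^T)D_jR_jAR_j^TD_j(I-\xi_{0j})\mathbf V_{jk}=\lambda_{jk}A_j^{Neu}\mathbf V_{jk},$$ where $(\mathbf V_{jk})_k$ is a basis of $\mathbb{R}^{n_j}$ of eigenvectors. For a threshold $\tau>0$, $V^\tau_{geneo}\subset\mathbb{R}^n$ is the span of all vectors $R_j^TD_j(I-\xi_{0j})\mathbf V_{jk}$ with $1\le j\le N$ and $\lambda_{jk}>\tau$. The coarse space is $V_0:=V_G+V^\tau_{geneo}$, and $Z$ is a full-column-rank matrix whose columns form a basis of $V_0$; $E:=Z^TAZ$ is the exact coarse matrix. $\lambda_{max}(E\tilde E^{-1})$ and $\lambda_{min}(E\tilde E^{-1})$ denote the largest and smallest eigenvalues of $E\tilde E^{-1}$ (all of which are real and positive). *)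

(* Defs.v *)
From mathcomp Require Export all_boot all_order all_algebra.
From mathcomp Require Export reals.

Set Implicit Arguments.
Unset Strict Implicit.
Unset Printing Implicit Defensive.

Import Order.TTheory GRing.Theory Num.Theory.
Local Open Scope ring_scope.

Definition dot (R : realType) (n : nat) (u v : 'cV[R]_n) : R :=
  (u^T *m v) 0 0.

(* A bilinear form on R^n is represented by its matrix M: (U, V) |-> (M U, V) *)
Definition bform (R : realType) (n : nat) (M : 'M[R]_n) (u v : 'cV[R]_n) : R :=
  dot (M *m u) v.

Definition is_spsd (R : realType) (n : nat) (M : 'M[R]_n) : Prop :=
  M^T = M /\ forall u : 'cV[R]_n, 0 <= bform M u u.

Definition is_spd (R : realType) (n : nat) (M : 'M[R]_n) : Prop :=
  M^T = M /\ forall u : 'cV[R]_n, u != 0 -> 0 < bform M u u.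

Definition is_lambda_max (R : realType) (m : nat) (M : 'M[R]_m) (l : R) : Prop :=
  eigenvalue M l /\ forall a : R, eigenvalue M a -> a <= l.

Definition is_lambda_min (R : realType) (m : nat) (M : 'M[R]_m) (l : R) : Prop :=
  eigenvalue M l /\ forall a : R, eigenvalue M a -> l <= a.

Definition mximg (R : realType) (m n : nat) (M : 'M[R]_(m, n))
    (S : {vspace 'cV[R]_n}) : {vspace 'cV[R]_m} :=
  (linfun (mulmx M : 'cV[R]_n -> 'cV[R]_m) @: S)%VS.

(* P is the B-orthogonal projection onto S; it exists and is unique when B is
   symmetric positive definite. *)
Definition is_orth_proj (R : realType) (n : nat) (B : 'M[R]_n)
    (S : {vspace 'cV[R]_n}) (P : 'M[R]_n) : Prop :=
  forall u : 'cV[R]_n,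
    P *m u \in S /\
    forall g : 'cV[R]_n, g \in S -> bform B (u - P *m u) g = 0.

(* T is the set of mesh elements, edof K the set of degrees of freedom carried
   by the element K; a subdomain is the set W of the elements it is made of. *)
Definition subdofs (T : finType) (n : nat) (edof : T -> {set 'I_n})
    (W : {set T}) : {set 'I_n} :=
  \bigcup_(K in W) edof K.

Definition restr_mx (R : realType) (n : nat) (I : {set 'I_n}) :
    'M[R]_(#|I|, n) :=
  \matrix_(k, l) (enum_val k == l)%:R.

Section Decomposition.

Variables (R : realType) (n N : nat) (A : 'M[R]_n).
Variables (T : finType) (edof : T -> {set 'I_n}) (Omega : 'I_N -> {set T}).

Definition ndofs (i : 'I_N) : nat := #|subdofs edof (Omega i)|.

Definition Rm (i : 'I_N) : 'M[R]_(ndofs i, n) :=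
  restr_mx R (subdofs edof (Omega i)).

Definition Bm (i : 'I_N) : 'M[R]_(ndofs i) := Rm i *m A *m (Rm i)^T.

Definition k0 : nat :=
  (\max_(i < N) #|[set j : 'I_N | Rm j *m A *m (Rm i)^T != 0%R]|)%N.

Definition k1 : nat := (\max_(K : T) #|[set i : 'I_N | K \in Omega i]|)%N.

Variable D : forall i : 'I_N, 'M[R]_(ndofs i).

Definition Gloc (G : {vspace 'cV[R]_n}) (i : 'I_N) :
    {vspace 'cV[R]_(ndofs i)} :=
  mximg (Rm i) G.

Definition VG (G : {vspace 'cV[R]_n}) : {vspace 'cV[R]_n} :=
  (\sum_(i < N) mximg ((Rm i)^T *m D i) (Gloc G i))%VS.

Variable xi : forall i : 'I_N, 'M[R]_(ndofs i).

Definition geneo_mx (j : 'I_N) : 'M[R]_(ndofs j) :=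
  (1%:M - (xi j)^T) *m D j *m Rm j *m A *m (Rm j)^T *m D j *m (1%:M - xi j).

(* (v k)_k is a basis of R^(n_j) made of eigenvectors of the generalized
   eigenvalue problem of subdomain j, with eigenvalues (lam k)_k. *)
Definition is_geneo_eigenbasis (j : 'I_N) (ANeu : 'M[R]_(ndofs j))
    (v : 'I_(ndofs j) -> 'cV[R]_(ndofs j)) (lam : 'I_(ndofs j) -> R) : Prop :=
  basis_of fullv (codom v) /\
  forall k : 'I_(ndofs j), geneo_mx j *m v k = lam k *: (ANeu *m v k).

Definition Vgeneo (v : forall j : 'I_N, 'I_(ndofs j) -> 'cV[R]_(ndofs j))
    (lam : forall j : 'I_N, 'I_(ndofs j) -> R) (tau : R) : {vspace 'cV[R]_n} :=
  (\sum_(j < N) \sum_(k < ndofs j | tau < lam j k)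
     <[(Rm j)^T *m D j *m (1%:M - xi j) *m v j k]>)%VS.

Definition P0t (m : nat) (Z : 'M[R]_(n, m)) (Et : 'M[R]_m) : 'M[R]_n :=
  Z *m invmx Et *m Z^T *m A.

Definition MinvAS2 (m : nat) (Z : 'M[R]_(n, m)) (Et : 'M[R]_m) : 'M[R]_n :=
  Z *m invmx Et *m Z^T +
  (1%:M - P0t Z Et)
    *m (\sum_(i < N) (Rm i)^T *m invmx (Bm i) *m Rm i)
    *m (1%:M - (P0t Z Et)^T).

End Decomposition.

Definition coarse_mx (R : realType) (n m : nat) (A : 'M[R]_n)
    (Z : 'M[R]_(n, m)) : 'M[R]_m :=
  Z^T *m A *m Z.

Definition cR (R : realType) (k0 : nat) (lp eps : R) : R :=
  (k0%:R * (1 + eps ^+ 2) + lp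
   + Num.sqrt ((k0%:R * (1 + eps ^+ 2) - lp) ^+ 2
               + 4%:R * lp * k0%:R * eps ^+ 2)) / 2%:R.

Definition cT (R : realType) (k0 k1 : nat) (tau lm eps : R) : R :=
  lm / ((1 + eps * Num.sqrt (k0%:R * k1%:R * tau)) ^+ 2 + lm * k1%:R * tau).

(* Main.v *)
From mathcomp Require Import boolp classical_sets ring lra.
Require Import Defs.

Set Implicit Arguments.
Unset Strict Implicit.
Unset Printing Implicit Defensive.

Import Order.TTheory GRing.Theory Num.Theory.
Local Open Scope ring_scope.

(* Let P be the a-orthogonal projection onto the coarse space (P0t with the exact
   coarse matrix) and Q := P0t with the inexact one. The operator P - Q is
   a-self-adjoint and factors through P; the pencil bounds lm Et <= E <= lp Et
   give it a-norm at most epsA.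
   Upper bound: (1 - P) U and (P - Q) U are a-orthogonal and the local solves are
   bounded by k0, so the energy is at most lp |PU|^2 + k0 (|(1 - P)U|^2 +
   epsA^2 |PU|^2), and cR dominates both k0 and lp + k0 epsA^2.
   Lower bound: writing U = V + W with V in the coarse space and
   W = sum_i R_i^T W_i, where W_i is obtained from the low GenEO modes of R_i U,
   one has U = Z c + (1 - Q) W with Z c = P U - (P - Q) W. This decomposition is
   stable with constant 1 / cT, and Young's inequality concludes (the fictitious
   space lemma). *)

(** * Quadratic forms of matrices: Young inequalities, order reversal, norm bounds *)

Section BilinearForms.
Variable R : realType.

Lemma dotC n (u v : 'cV[R]_n) : dot u v = dot v u.
Proof. by rewrite /dot -[u^T *m v]trmxK trmx_mul trmxK mxE. Qed.

Lemma dotE n (u v : 'cV[R]_n) : dot u v = \sum_i u i 0 * v i 0.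
Proof. by rewrite /dot mxE; apply: eq_bigr => i _; rewrite mxE. Qed.

Lemma dot_mulmxl m n (M : 'M[R]_(m, n)) u v : dot (M *m u) v = dot u (M^T *m v).
Proof. by rewrite /dot trmx_mul mulmxA. Qed.

Lemma dotDl n (u v w : 'cV[R]_n) : dot (u + v) w = dot u w + dot v w.
Proof. by rewrite /dot linearD mulmxDl mxE. Qed.

Lemma dotZl n a (u v : 'cV[R]_n) : dot (a *: u) v = a * dot u v.
Proof. by rewrite /dot linearZ -scalemxAl mxE. Qed.

Lemma dotDr n (u v w : 'cV[R]_n) : dot u (v + w) = dot u v + dot u w.
Proof. by rewrite /dot mulmxDr mxE. Qed.

Lemma dot_sumr n (I : Type) (r : seq I) (P : pred I) (F : I -> 'cV[R]_n) u :
  dot u (\sum_(i <- r | P i) F i) = \sum_(i <- r | P i) dot u (F i).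
Proof. by rewrite /dot mulmx_sumr summxE. Qed.

Lemma dot_suml n (I : Type) (r : seq I) (P : pred I) (F : I -> 'cV[R]_n) u :
  dot (\sum_(i <- r | P i) F i) u = \sum_(i <- r | P i) dot (F i) u.
Proof. by rewrite dotC dot_sumr; apply: eq_bigr => i _; rewrite dotC. Qed.

Lemma dot_ge0 n (u : 'cV[R]_n) : 0 <= dot u u.
Proof. by rewrite dotE; apply: sumr_ge0 => i _; rewrite -expr2 sqr_ge0. Qed.

Lemma bformDl n (M : 'M[R]_n) u v w :
  bform M (u + v) w = bform M u w + bform M v w.
Proof. by rewrite /bform mulmxDr dotDl. Qed.

Lemma bformDr n (M : 'M[R]_n) u v w :
  bform M u (v + w) = bform M u v + bform M u w.
Proof. exact: dotDr. Qed.

Lemma bformZl n (M : 'M[R]_n) a u v : bform M (a *: u) v = a * bform M u v.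
Proof. by rewrite /bform -scalemxAr dotZl. Qed.

Lemma bformZr n (M : 'M[R]_n) a u v : bform M u (a *: v) = a * bform M u v.
Proof. by rewrite /bform dotC dotZl dotC. Qed.

Lemma bformNl n (M : 'M[R]_n) u v : bform M (- u) v = - bform M u v.
Proof. by rewrite -scaleN1r bformZl mulN1r. Qed.

Lemma bformNr n (M : 'M[R]_n) u v : bform M u (- v) = - bform M u v.
Proof. by rewrite -scaleN1r bformZr mulN1r. Qed.

Lemma bform0l n (M : 'M[R]_n) v : bform M 0 v = 0.
Proof. by rewrite -(scale0r 0) bformZl mul0r. Qed.

Lemma bform_suml n (M : 'M[R]_n) (I : Type) (r : seq I) (P : pred I) F v :
  bform M (\sum_(i <- r | P i) F i) v = \sum_(i <- r | P i) bform M (F i) v.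
Proof. by rewrite /bform mulmx_sumr dot_suml. Qed.

Lemma bform_sumr n (M : 'M[R]_n) (I : Type) (r : seq I) (P : pred I) F v :
  bform M v (\sum_(i <- r | P i) F i) = \sum_(i <- r | P i) bform M v (F i).
Proof. exact: dot_sumr. Qed.

Lemma bformC n (M : 'M[R]_n) u v : M^T = M -> bform M u v = bform M v u.
Proof. by move=> sM; rewrite /bform dot_mulmxl sM dotC. Qed.

Definition bformE := (bformDl, bformDr, bformNl, bformNr, bformZl, bformZr).

Lemma bform_mulmx m n (M : 'M[R]_n) (L : 'M[R]_(n, m)) u v :
  bform M (L *m u) (L *m v) = bform (L^T *m M *m L) u v.
Proof. by rewrite /bform -!mulmxA dotC dot_mulmxl dotC. Qed.

Lemma bform_mxD n (M1 M2 : 'M[R]_n) u v :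
  bform (M1 + M2) u v = bform M1 u v + bform M2 u v.
Proof. by rewrite /bform mulmxDl dotDl. Qed.

Lemma bform_mxZ n a (M : 'M[R]_n) u v : bform (a *: M) u v = a * bform M u v.
Proof. by rewrite /bform -scalemxAl dotZl. Qed.

Lemma bform_mxN n (M : 'M[R]_n) u v : bform (- M) u v = - bform M u v.
Proof. by rewrite -scaleN1r bform_mxZ mulN1r. Qed.

Lemma bform_mx_sum n (I : Type) (r : seq I) (P : pred I) (M : I -> 'M[R]_n) u v :
  bform (\sum_(i <- r | P i) M i) u v = \sum_(i <- r | P i) bform (M i) u v.
Proof. by rewrite /bform mulmx_suml dot_suml. Qed.

Lemma spsd_spd n (M : 'M[R]_n) : is_spd M -> is_spsd M.
Proof.
case=> sM pM; split=> // u; have [->|u0] := eqVneq u 0; first by rewrite bform0l.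
exact/ltW/pM.
Qed.

Lemma spd_unitmx n (M : 'M[R]_n) : is_spd M -> M \in unitmx.
Proof.
case=> sM pM; rewrite -row_free_unit -kermx_eq0.
apply/eqP/row_matrixP => i; rewrite row0; apply/eqP.
rewrite -trmx_eq0; apply: contraT => /pM.
have rM : row i (kermx M) *m M = 0 by rewrite -row_mul mulmx_ker row0.
by rewrite /bform -{1}sM -trmx_mul rM trmx0 -[0 : 'cV_n](scale0r 0) dotZl mul0r ltxx.
Qed.

Lemma trmx_invmx_sym n (M : 'M[R]_n) : M^T = M -> (invmx M)^T = invmx M.
Proof. by move=> sM; rewrite trmx_inv sM. Qed.

Lemma bform_invmx n (M : 'M[R]_n) u v : M^T = M -> M \in unitmx ->
  bform M (invmx M *m u) (invmx M *m v) = bform (invmx M) u v.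
Proof. by move=> sM uM; rewrite bform_mulmx trmx_invmx_sym // mulVmx // mul1mx. Qed.

(** Expansion of the nonnegative form of [M] at [x - invmx M *m y]. *)
Lemma young_spd n (M : 'M[R]_n) x y : is_spd M ->
  2 * dot x y <= bform M x x + bform (invmx M) y y.
Proof.
move=> pM; have [sM _] := pM; have uM := spd_unitmx pM.
have /spsd_spd [_ /(_ (x - invmx M *m y))] := pM.
rewrite !bformE bform_invmx // {3}/bform mulKVmx // dotC bformC //.
by rewrite /bform mulKVmx // (dotC y x); lra.
Qed.

Lemma young_spsd n (M : 'M[R]_n) x y : is_spsd M ->
  2 * bform M x y <= bform M x x + bform M y y.
Proof.
by move=> [sM /(_ (x - y))]; rewrite !bformE (bformC y x sM); lra.
Qed.

(** Inversion reverses the order of positive definite forms. Young's inequality for [X] at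
    [s^-1 *: (invmx Y *m u)] and [u] gives this without matrix square roots. *)
Lemma bform_invmx_le n (X Y : 'M[R]_n) s : is_spd X -> is_spd Y -> 0 < s ->
  (forall u, bform X u u <= s * bform Y u u) ->
  forall u, bform (invmx Y) u u <= s * bform (invmx X) u u.
Proof.
move=> pX pY s0 XY u; have [sY _] := pY; have uY := spd_unitmx pY.
have := young_spd (s^-1 *: (invmx Y *m u)) u pX.
rewrite dotZl -/(bform (invmx Y) u u) !bformE => H.
have := XY (invmx Y *m u); rewrite bform_invmx // => H2.
move: H2 H; set x := bform X _ _; set y := bform _ u u; set z := bform _ u u.
move=> H2 H.
have H3 : s^-1 * x <= y by rewrite ler_pdivrMl.
have H4 : s^-1 * (s^-1 * x) <= s^-1 * y by rewrite ler_pM2l // invr_gt0.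
by rewrite -ler_pdivrMl //; lra.
Qed.

(* by polarization of the symmetric form [bform A (T *m u) v] *)
Lemma selfadjoint_norm_le n (A T : 'M[R]_n) e : is_spsd A -> 0 <= e ->
  (forall u v, bform A (T *m u) v = bform A u (T *m v)) ->
  (forall u, `|bform A (T *m u) u| <= e * bform A u u) ->
  forall u, bform A (T *m u) (T *m u) <= e ^+ 2 * bform A u u.
Proof.
move=> [sA pA] e0 saT bT u.
have key d : 2 * bform A (T *m u) d <= e * (bform A u u + bform A d d).
  have := bT (u + d); have := bT (u - d).
  rewrite !mulmxDr !mulmxN !bformE (saT d u) (bformC d (T *m u) sA) (bformC d u sA).
  rewrite !ler_norml => /andP[h1 _] /andP[_ h2]; lra.
have [e1|e1] := eqVneq e 0.
  by have := key (T *m u); rewrite e1 !mul0r expr0n mul0r; lra.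
have {}e0 : 0 < e by rewrite lt_def e1.
(* The factor [e^-1] is the optimal scaling of the test vector: half of the left side is absorbed by
   the energy of [T *m u] on the right. *)
have := key (e^-1 *: (T *m u)); rewrite !bformE.
set x := bform A u u; set y := bform A _ _ => H.
have : e * (2 * (e^-1 * y)) <= e * (e * (x + e^-1 * (e^-1 * y))) by rewrite ler_pM2l.
have -> : e * (2 * (e^-1 * y)) = 2 * y by field.
have -> : e * (e * (x + e^-1 * (e^-1 * y))) = e ^+ 2 * x + y by field.
lra.
Qed.

Lemma bform_le_dot n (M : 'M[R]_n) :
  exists2 C, 0 < C & forall u, bform M u u <= C * dot u u.
Proof.
exists (1 + \sum_i \sum_j `|M i j|).
  by rewrite ltr_wpDr //; do 2![apply: sumr_ge0 => ? _].
move=> u; rewrite mulrDl mul1r ler_wpDl ?dot_ge0 //.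
have sq i : u i 0 ^+ 2 <= dot u u.
  rewrite dotE (bigD1 i) //= -expr2 lerDl; apply: sumr_ge0 => j _.
  by rewrite -expr2 sqr_ge0.
rewrite /bform [dot _ _]dotE mulr_suml; apply: ler_sum => i _.
rewrite mxE !mulr_suml; apply: ler_sum => j _.
rewrite (le_trans (ler_norm _)) // -mulrA normrM ler_wpM2l //.
have h1 := sq i; have h2 := sq j.
have h3 := sqr_ge0 (u j 0 - u i 0); have h4 := sqr_ge0 (u j 0 + u i 0).
by rewrite ler_norml; apply/andP; split; nra.
Qed.

(** Quantitative positivity without a spectral theorem. Since [u] is recovered from [X *m u], the
    form of [M] is bounded by [dot (X *m u) (X *m u)]; nonnegativity of [X] at
    [u - C^-1 *: (X *m u)] bounds the latter by [C * bform X u u]. *)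
Lemma spsd_unit_dominates n (X : 'M[R]_n) : is_spsd X -> X \in unitmx ->
  forall M : 'M[R]_n, exists2 K, 0 < K & forall u, bform M u u <= K * bform X u u.
Proof.
move=> [sX pX] uX M.
have [C C0 hC] := bform_le_dot X.
have [K K0 hK] := bform_le_dot ((invmx X)^T *m M *m invmx X).
exists (K * C) => [|u]; first exact: mulr_gt0.
rewrite -{1 2}(mulKmx uX u) bform_mulmx.
apply: le_trans (hK _) _; rewrite -mulrA ler_pM2l //.
have := pX (u - C^-1 *: (X *m u)); rewrite !bformE.
have := hC (X *m u); rewrite (bformC _ u sX) {2}/bform -/(bform X u u).
have -> : bform X u (X *m u) = dot (X *m u) (X *m u) by [].
set w := dot _ _ => H1 H2.
have H3 : C^-1 * (C^-1 * bform X (X *m u) (X *m u)) <= C^-1 * w.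
  by rewrite ler_pM2l ?invr_gt0 // ler_pdivrMl.
by rewrite -ler_pdivrMl //; lra.
Qed.

End BilinearForms.

(** * Extreme eigenvalues of symmetric pencils and the form bounds they give *)

Section Pencils.
Variable R : realType.

Lemma unitmx_opp m (M : 'M[R]_m) : (- M \in unitmx) = (M \in unitmx).
Proof. by rewrite -scaleN1r unitmxZ // unitrN1. Qed.

Lemma eigenvalue_pencil m (E F : 'M[R]_m) s : F \in unitmx ->
  eigenvalue (E *m invmx F) s = (s *: F - E \notin unitmx).
Proof.
move=> uF; rewrite /eigenvalue /eigenspace kermx_eq0 row_free_unit.
have -> : E *m invmx F - s%:M = - ((s *: F - E) *m invmx F).
  by rewrite mulmxBl -scalemxAl mulmxV // scalemx1 opprB.
by rewrite unitmx_opp unitmx_mul unitmx_inv uF andbT.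
Qed.

(** The witness is the supremum of the Rayleigh quotients, and no compactness argument is used. If
    [s *: F - E] were invertible, this semidefinite matrix would dominate [K^-1 *: F], so [s - K^-1]
    would still be an upper bound. *)
Lemma sup_rayleigh_eigenvalue m (E F : 'M[R]_m) : (0 < m)%N ->
  E^T = E -> is_spd F ->
  exists2 s, eigenvalue (E *m invmx F) s &
    forall u, bform E u u <= s * bform F u u.
Proof.
move=> m0 sE pF; have [sF posF] := pF; have uF := spd_unitmx pF.
pose S := [set r | exists2 u : 'cV[R]_m, u != 0 & r = bform E u u / bform F u u]%classic.
have supS : has_sup S.
  split.
    exists (bform E (const_mx 1) (const_mx 1) / bform F (const_mx 1) (const_mx 1)).
    exists (const_mx 1) => //; apply/eqP => /matrixP /(_ (Ordinal m0) 0).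
    by rewrite !mxE => /eqP; rewrite oner_eq0.
  have [K _ hK] := spsd_unit_dominates (spsd_spd pF) uF E.
  by exists K => _ [u u0 ->]; rewrite ler_pdivrMr ?posF.
have hS u : bform E u u <= sup S * bform F u u.
  have [->|u0] := eqVneq u 0; first by rewrite !bform0l mulr0.
  rewrite -ler_pdivrMr ?posF //; apply: sup_upper_bound => //; by exists u.
exists (sup S) => //; rewrite eigenvalue_pencil //; apply/negP => uX.
have pX : is_spsd (sup S *: F - E).
  split=> [|u]; first by rewrite linearB linearZ /= sE sF.
  by rewrite bform_mxD bform_mxN bform_mxZ subr_ge0.
have [K K0 hK] := spsd_unit_dominates pX uX F.
have : sup S <= sup S - K^-1.
  apply: ge_sup => [|_ [u u0 ->]]; first exact: supS.1.
  rewrite ler_pdivrMr ?posF // mulrBl lerBrDr -lerBrDl ler_pdivrMl //.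
  by have := hK u; rewrite bform_mxD bform_mxN bform_mxZ.
by rewrite lerBrDr gerDl leNgt invr_gt0 K0.
Qed.

Lemma eigenvalue_dim_gt0 m (M : 'M[R]_m) s : eigenvalue M s -> (0 < m)%N.
Proof. by case: m M => // M; rewrite /eigenvalue flatmx0 eqxx. Qed.

Lemma lambda_max_pencil m (E F : 'M[R]_m) l : E^T = E -> is_spd F ->
  is_lambda_max (E *m invmx F) l -> forall u, bform E u u <= l * bform F u u.
Proof.
move=> sE pF [el ml] u; have m0 := eigenvalue_dim_gt0 el.
have [s /ml sl /(_ u) h] := sup_rayleigh_eigenvalue m0 sE pF.
by apply: le_trans h _; rewrite ler_wpM2r // (spsd_spd pF).2.
Qed.

Lemma lambda_min_pencil m (E F : 'M[R]_m) l : E^T = E -> is_spd F ->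
  is_lambda_min (E *m invmx F) l -> forall u, l * bform F u u <= bform E u u.
Proof.
move=> sE pF [el ml] u; have m0 := eigenvalue_dim_gt0 el.
have sNE : (- E)^T = - E by rewrite linearN /= sE.
(* The infimum for [E] is the opposite of the supremum for [- E]. *)
have [s] := sup_rayleigh_eigenvalue m0 sNE pF.
have uF := spd_unitmx pF; rewrite eigenvalue_pencil // opprK => es /(_ u).
have /ml ls : eigenvalue (E *m invmx F) (- s).
  by rewrite eigenvalue_pencil // scaleNr -opprD unitmx_opp.
rewrite bform_mxN lerNl => h; apply: le_trans h.
by rewrite -mulNr ler_wpM2r // (spsd_spd pF).2.
Qed.

(** For [l <= 0] the matrix [E - l *: F] is positive definite, hence invertible. *)
Lemma eigenvalue_spd_gt0 m (E F : 'M[R]_m) l : is_spd E -> is_spd F ->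
  eigenvalue (E *m invmx F) l -> 0 < l.
Proof.
move=> pE pF; have uF := spd_unitmx pF; rewrite eigenvalue_pencil // => nu.
rewrite ltNge; apply/negP => l0; case/negP: nu.
rewrite -opprB unitmx_opp; apply: spd_unitmx; split.
  by rewrite linearB linearZ /= pE.1 pF.1.
move=> u u0; rewrite bform_mxD bform_mxN bform_mxZ -mulNr.
by rewrite ltr_wpDr ?pE.2 // mulr_ge0 ?oppr_ge0 // (spsd_spd pF).2.
Qed.

End Pencils.

(** * Coordinates in families of vectors, and splitting along pencil eigenvectors *)

Section Families.
Variable R : realType.

Lemma mem_span_codom (V : vectType R) m (f : 'I_m -> V) w :
  w \in <<codom f>>%VS -> exists c, w = \sum_k c k *: f k.
Proof.
rewrite span_def big_image /= => /memv_sumP [w_ hw ->].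
have /fin_all_exists [c hc] k : exists a, w_ k = a *: f k.
  by have /vlineP [a] := hw k isT; exists a.
by exists c; apply: eq_bigr.
Qed.

Lemma free_codom (V : vectType R) m (f : 'I_m -> V) c :
  free (codom f) -> \sum_k c k *: f k = 0 -> forall k, c k = 0.
Proof.
move=> fr sum0 k; have {}fr := freeP (X := codom_tuple f) fr.
rewrite -(enum_rankK k); apply: (fr (fun i => c (enum_val i))).
rewrite -{}[RHS]sum0 [RHS](reindex (@enum_val _ 'I_m)); last first.
  by apply: onW_bij; exists enum_rank => i; rewrite ?enum_valK ?enum_rankK.
by apply: eq_bigr => i _; rewrite /= nth_image.
Qed.

Lemma mulmx_sum_col n m (Z : 'M[R]_(n, m)) c :
  Z *m (\col_k c k) = \sum_k c k *: col k Z.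
Proof.
apply/matrixP => i j; rewrite mxE summxE; apply: eq_bigr => k _.
by rewrite !mxE mulrC.
Qed.

Lemma spd_congruence n m (A : 'M[R]_n) (L : 'M[R]_(n, m)) : is_spd A ->
  (forall c : 'cV_m, L *m c = 0 -> c = 0) -> is_spd (L^T *m A *m L).
Proof.
move=> [sA pA] injL; split=> [|u u0].
  by rewrite !trmx_mul trmxK sA mulmxA.
by rewrite -bform_mulmx pA //; apply: contra_neq u0 => /injL.
Qed.

(* The eigenvectors need not be [C]-orthogonal inside an eigenspace. Cross terms
   only survive between equal eigenvalues, where [tau - lam k] factors as
   [sqrt (tau - lam k) * sqrt (tau - lam l)]; hence [tau C - M] is a square on the
   low part. *)
Lemma pencil_low_high d (M C : 'M[R]_d) (v : 'I_d -> 'cV[R]_d) lam tau :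
  M^T = M -> is_spsd C -> 0 <= tau -> basis_of fullv (codom v) ->
  (forall k, M *m v k = lam k *: (C *m v k)) ->
  forall u, exists w c, u = w + \sum_(k | tau < lam k) c k *: v k /\
    bform M w w <= tau * bform C u u.
Proof.
move=> sM [sC pC] tau0 bv ev u.
have orth k l : lam k != lam l -> bform C (v k) (v l) = 0.
  move=> kl; have : bform M (v k) (v l) = bform M (v l) (v k) by apply: bformC.
  rewrite /bform !ev !dotZl -!/(bform _ _ _) (bformC (v l) _ sC) => /eqP.
  by rewrite -subr_eq0 -mulrBl mulf_eq0 subr_eq0 (negbTE kl) => /eqP.
have [c uE] : exists c, u = \sum_k c k *: v k.
  by apply: mem_span_codom; rewrite (span_basis bv) memvf.
pose w := \sum_(k | ~~ (tau < lam k)) c k *: v k.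
pose h := \sum_(k | tau < lam k) c k *: v k.
have uwh : u = w + h by rewrite uE (bigID (fun k => tau < lam k)) addrC.
exists w, c; split=> //.
have wh : bform C w h = 0.
  rewrite bform_suml big1 // => k hk; rewrite bform_sumr big1 // => l hl.
  rewrite !bformE orth ?mulr0 //; apply: contraNneq hk => ->; exact: hl.
have Cu : bform C w w <= bform C u u.
  by rewrite uwh !bformE wh (bformC h _ sC) wh add0r addr0 lerDl.
apply: le_trans (_ : tau * bform C w w <= _); last by rewrite ler_wpM2l.
pose z := \sum_(k | ~~ (tau < lam k)) (c k * Num.sqrt (tau - lam k)) *: v k.
rewrite -subr_ge0 (_ : _ - _ = bform C z z) //.
rewrite !bform_suml mulr_sumr -sumrB; apply: eq_bigr => k hk.
rewrite !bform_sumr mulr_sumr -sumrB; apply: eq_bigr => l hl.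
rewrite !bformE /bform ev dotZl -!/(bform _ _ _).
have [kl|kl] := eqVneq (lam k) (lam l); last by rewrite orth //; ring.
have -> : c k * Num.sqrt (tau - lam k) * (c l * Num.sqrt (tau - lam l) * bform C (v k) (v l))
  = Num.sqrt (tau - lam k) ^+ 2 * (c k * c l * bform C (v k) (v l)) by rewrite -kl; ring.
by rewrite sqr_sqrtr ?subr_ge0 ?leNgt //; ring.
Qed.

End Families.

(** * Abstract additive Schwarz theory *)

Section Schwarz.
Variable R : realType.

Lemma young_spd_scaled n (M : 'M[R]_n) x y s : is_spd M -> 0 < s ->
  2 * dot x y <= s^-1 * bform M x x + s * bform (invmx M) y y.
Proof.
move=> pM s0; have := young_spd (s^-1 *: x) y pM; rewrite dotZl !bformE.
rewrite -(ler_pM2l s0) mulrDr.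
have -> : s * (2 * (s^-1 * dot x y)) = 2 * dot x y by field; rewrite gt_eqF.
by rewrite (mulrA s) divff ?gt_eqF // mul1r.
Qed.

(** Triangle inequality for the [M]-norm in squared form; the cross term is bounded by Young's
    inequality with weight [g]. *)
Lemma spsd_add_le n (M : 'M[R]_n) x y S g : is_spd M -> 0 <= g ->
  bform M x x <= S -> bform M y y <= g ^+ 2 * S ->
  bform M (x + y) (x + y) <= (1 + g) ^+ 2 * S.
Proof.
move=> pM g0 hx hy; have [sM posM] := pM.
have S0 : 0 <= S by apply: le_trans hx; exact: (spsd_spd pM).2.
(* For nonzero [y] the bound on its energy forces [g] to be positive, so that [g^-1] can serve as a
   weight. *)
have [y0|y0] := eqVneq y 0.
  rewrite y0 addr0 (le_trans hx) // ler_peMl //; nra.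
have {}g0 : 0 < g.
  rewrite lt_def g0 andbT; apply: contraTneq hy => ->.
  by rewrite expr0n mul0r -ltNge posM.
have := young_spsd x (g^-1 *: y) (spsd_spd pM); rewrite !bformE (bformC y x sM).
move: hx hy; set X := bform M x x; set Y := bform M y y; set c := bform M x y.
move=> hx hy; rewrite -(ler_pM2l g0).
have -> : g * (2 * (g^-1 * c)) = 2 * c by field; rewrite gt_eqF.
have hY : g^-1 * Y <= g * S.
  by rewrite ler_pdivrMl // mulrA -expr2.
have -> : g * (X + g^-1 * (g^-1 * Y)) = g * X + g^-1 * Y by field; rewrite gt_eqF.
have hX : g * X <= g * S by rewrite ler_pM2l.
have -> : (1 + g) ^+ 2 * S = S + 2 * (g * S) + g ^+ 2 * S by ring.
lra.
Qed.

(** * Overlap counting and local solves *)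

Section Subdomains.
Variables (n : nat) (I : finType) (d : I -> nat) (A : 'M[R]_n).
Variable r : forall i, 'M[R]_(d i, n).
Hypothesis pA : is_spd A.
Hypothesis pB : forall i, is_spd (r i *m A *m (r i)^T).
Variable k : nat.
Hypothesis hk : forall i, (#|[set j | r j *m A *m  (r i)^T != 0%R]| <= k)%N.

Local Notation B i := (r i *m A *m (r i)^T).

(** Only coupled pairs contribute to the double sum. Young's inequality splits each such term evenly
    between its two indices, and every index has at most [k] partners. *)
Lemma overlap_norm_le (u : forall i, 'cV[R]_(d i)) :
  bform A (\sum_i (r i)^T *m u i) (\sum_i (r i)^T *m u i)
    <= k%:R * \sum_i bform (B i) (u i) (u i).
Proof.
have [sA _] := pA.
pose b i := bform (B i) (u i) (u i).
pose c i j : bool := r j *m A *m (r i)^T != 0.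
have cC i j : c i j = c j i.
  by rewrite /c -[in RHS]trmx_eq0 !trmx_mul trmxK sA mulmxA.
have bA i : bform A ((r i)^T *m u i) ((r i)^T *m u i) = b i.
  by rewrite bform_mulmx trmxK.
have term i j : 2 * bform A ((r i)^T *m u i) ((r j)^T *m u j)
    <= (c i j)%:R * b i + (c i j)%:R * b j.
  have [cij|/negbNE/eqP cij] := boolP (c i j).
    by rewrite !mul1r -!bA; apply/young_spsd/spsd_spd.
  rewrite /bform dotC dot_mulmxl trmxK !mulmxA cij mul0mx dotC.
  by rewrite -[0 : 'cV_(d j)](scale0r 0) dotZl !(mul0r, mulr0) addr0.
rewrite -(ler_pM2l (ltr0Sn R 1)) bform_suml mulr_sumr.
apply: (@le_trans _ _ (\sum_i \sum_j ((c i j)%:R * b i + (c i j)%:R * b j))).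
  apply: ler_sum => i _; rewrite bform_sumr mulr_sumr.
  by apply: ler_sum => j _; exact: term.
under eq_bigr do rewrite big_split /=.
rewrite big_split /= [X in _ + X]exchange_big /=.
under [X in _ + X]eq_bigr => i _ do under eq_bigr => j _ do rewrite cC.
have -> (x : R) : 2 * x = x + x by ring.
suff h : \sum_i \sum_j (c i j)%:R * b i <= k%:R * \sum_i b i by exact: lerD.
rewrite mulr_sumr; apply: ler_sum => i _; rewrite -mulr_suml ler_wpM2r //.
  exact: (spsd_spd (pB i)).2.
rewrite -natr_sum ler_nat (leq_trans _ (hk i)) // -sum1_card [leqRHS]big_mkcond /=.
by apply: leq_sum => j _; rewrite inE /c; case: (_ != 0).
Qed.

(** Dual to the overlap bound. With [W] the sum of the extended local solutions, the left side [s]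
    equals [bform A u W], while [W] has energy at most [k s]; nonnegativity at [k u - W]
    concludes. *)
Lemma local_solves_le u :
  \sum_i bform (invmx (B i)) (r i *m A *m u) (r i *m A *m u)
    <= k%:R * bform A u u.
Proof.
set s := \sum_i _; have [sA _] := pA.
pose w i := invmx (B i) *m (r i *m A *m u).
have sE : \sum_i bform (B i) (w i) (w i) = s.
  by apply: eq_bigr => i _; rewrite bform_invmx ?spd_unitmx //; case: (pB i).
pose W := \sum_i (r i)^T *m w i.
have uW : bform A u W = s.
  rewrite bform_sumr; apply: eq_bigr => i _.
  by rewrite /bform dotC dot_mulmxl trmxK mulmxA.
have WW := overlap_norm_le w; rewrite -/W sE in WW.
(* For [k = 0] the overlap bound forces [W = 0], hence [s = 0]; the main argument divides by [k]. *)
have [k0|k0] := posnP k.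
  have W0 : W = 0.
    apply: contraTeq WW => W0; rewrite k0 mul0r -ltNge; exact: pA.2.
  by rewrite -uW W0 bformC // bform0l k0 mul0r.
have := (spsd_spd pA).2 (k%:R *: u - W).
rewrite !bformE (bformC W u sA) uW => h.
have {k0} : (0 < k%:R :> R) by rewrite ltr0n.
move: (k%:R) WW h => t WW h t0.
have : t * s <= t * (t * bform A u u) by nra.
by rewrite ler_pM2l.
Qed.

End Subdomains.

(** * Exact and inexact coarse corrections, and the two energy bounds *)

Section CoarseCorrection.
Variables (n m : nat) (A : 'M[R]_n) (Z : 'M[R]_(n, m)).
Hypothesis pA : is_spd A.

Lemma P0t_selfadjoint (F : 'M[R]_m) u v : is_spd F ->
  bform A (P0t A Z F *m u) v = bform A u (P0t A Z F *m v).
Proof.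
move=> [sF _]; rewrite /bform !dot_mulmxl /P0t !trmx_mul trmxK trmx_invmx_sym //.
by rewrite pA.1 !mulmxA.
Qed.

Lemma bform_P0t (F : 'M[R]_m) u :
  bform A (P0t A Z F *m u) u = bform (invmx F) (Z^T *m A *m u) (Z^T *m A *m u).
Proof.
rewrite [RHS]/bform [RHS]dotC dot_mulmxl !trmx_mul trmxK pA.1 dotC.
by rewrite /P0t /bform !mulmxA.
Qed.

Variables (F : 'M[R]_m) (lp lm eps : R).
Hypothesis pE : is_spd (coarse_mx A Z).
Hypothesis pF : is_spd F.
Hypothesis lm0 : 0 < lm.
Hypothesis hlp : forall u, bform (coarse_mx A Z) u u <= lp * bform F u u.
Hypothesis hlm : forall u, lm * bform F u u <= bform (coarse_mx A Z) u u.
Hypothesis lmp : lm <= lp.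
Hypothesis eps_lm : `|1 - lm| <= eps.
Hypothesis eps_lp : `|1 - lp| <= eps.

Local Notation P := (P0t A Z (coarse_mx A Z)).
Local Notation Q := (P0t A Z F).

Lemma P0t_exactl : P *m Q = Q.
Proof.
rewrite /P0t -!mulmxA (mulmxA A Z) (mulmxA Z^T (A *m Z)) (mulmxA Z^T A Z).
by rewrite -/(coarse_mx A Z) mulKmx // spd_unitmx.
Qed.

Lemma P0t_exactr : Q *m P = Q.
Proof.
rewrite /P0t -!mulmxA (mulmxA A Z) (mulmxA Z^T (A *m Z)) (mulmxA Z^T A Z).
by rewrite -/(coarse_mx A Z) mulKVmx // spd_unitmx.
Qed.

Lemma P0t_exact_idem : P *m P = P.
Proof.
rewrite {1 2}/P0t -!mulmxA (mulmxA A Z) (mulmxA Z^T (A *m Z)) (mulmxA Z^T A Z).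
by rewrite -/(coarse_mx A Z) mulKmx ?spd_unitmx // /P0t !mulmxA.
Qed.

Lemma P0t_exact_range (c : 'cV[R]_m) : P *m (Z *m c) = Z *m c.
Proof.
rewrite /P0t -!mulmxA (mulmxA A Z) (mulmxA Z^T (A *m Z)) (mulmxA Z^T A Z).
by rewrite -/(coarse_mx A Z) mulKmx // spd_unitmx.
Qed.

Lemma bform_P0t_exact u : bform A (P *m u) (P *m u) = bform A (P *m u) u.
Proof. by rewrite -P0t_selfadjoint // mulmxA P0t_exact_idem. Qed.

Lemma exact_pythagoras u :
  bform A (u - P *m u) (u - P *m u) + bform A (P *m u) (P *m u) = bform A u u.
Proof.
have := bform_P0t_exact u; rewrite !bformE (bformC u _ pA.1) => ->; ring.
Qed.

(** Both sides are forms of inverse coarse matrices at the same vector, so the pencil bound passes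
    through inversion. *)
Lemma bform_P0t_le u : bform A (Q *m u) u <= lp * bform A (P *m u) u.
Proof.
rewrite !bform_P0t; apply: bform_invmx_le => //; exact: lt_le_trans lmp.
Qed.

Lemma bform_P0t_ge u : lm * bform A (P *m u) u <= bform A (Q *m u) u.
Proof.
rewrite -ler_pdivlMl // !bform_P0t; apply: bform_invmx_le; rewrite ?invr_gt0 // => w.
by rewrite ler_pdivlMl.
Qed.

Lemma coarse_error_le u :
  bform A ((P - Q) *m u) ((P - Q) *m u) <= eps ^+ 2 * bform A (P *m u) (P *m u).
Proof.
have e0 : 0 <= eps by apply: le_trans eps_lm.
(* Applying the norm bound at [P *m u] leaves only the coarse energy on the right. *)
have -> : (P - Q) *m u = (P - Q) *m (P *m u).
  by rewrite mulmxA (mulmxBl P Q P) P0t_exact_idem P0t_exactr.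
apply: selfadjoint_norm_le => //; first exact: spsd_spd.
  by move=> x y; rewrite !mulmxBl !bformE !P0t_selfadjoint.
move=> x; rewrite mulmxBl !bformE.
have h1 := bform_P0t_le x; have h2 := bform_P0t_ge x.
have h3 := exact_pythagoras x.
have h4 := (spsd_spd pA).2 (x - P *m x); have h5 := (spsd_spd pA).2 (P *m x).
rewrite bform_P0t_exact in h3 h5.
move: eps_lm eps_lp; rewrite !ler_norml => /andP[l1 l2] /andP[l3 l4].
apply/andP; split; nra.
Qed.

Lemma residual_norm_le u :
  bform A (u - Q *m u) (u - Q *m u)
    <= bform A (u - P *m u) (u - P *m u) + eps ^+ 2 * bform A (P *m u) (P *m u).
Proof.
apply: le_trans (lerD (lexx _) (coarse_error_le u)).
have -> : u - Q *m u = (u - P *m u) + (P - Q) *m u.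
  by rewrite mulmxBl addrA subrK.
(* The range of [Q] lies in that of [P], whose elements are [A]-orthogonal to [u - P *m u]. *)
have o : bform A (u - P *m u) ((P - Q) *m u) = 0.
  have -> : (P - Q) *m u = P *m ((P - Q) *m u).
    by rewrite mulmxA mulmxBr P0t_exact_idem P0t_exactl.
  rewrite -P0t_selfadjoint // mulmxBr (mulmxA P) P0t_exact_idem subrr.
  exact: bform0l.
move: (u - _) ((P - Q) *m u) o => x y o.
by rewrite !bformE (bformC y x pA.1) o add0r addr0.
Qed.

Variables (I : finType) (d : I -> nat) (r : forall i, 'M[R]_(d i, n)).
Hypothesis pB : forall i, is_spd (r i *m A *m (r i)^T).
Variable k : nat.
Hypothesis hk : forall i, (#|[set j | r j *m A *m  (r i)^T != 0%R]| <= k)%N.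

Local Notation B i := (r i *m A *m (r i)^T).
Local Notation res u := (u - Q *m u).

(** [MinvAS2] for an arbitrary finite family of restriction matrices; convertible to it when [r] is
    [Rm]. *)
Definition schwarz_mx : 'M[R]_n :=
  Z *m invmx F *m Z^T +
  (1%:M - Q) *m (\sum_i (r i)^T *m invmx (B i) *m r i) *m (1%:M - Q^T).

Lemma schwarz_energy u :
  bform A (schwarz_mx *m A *m u) u = bform A (Q *m u) u
    + \sum_i bform (invmx (B i)) (r i *m A *m res u) (r i *m A *m res u).
Proof.
rewrite /schwarz_mx mulmxDl mulmxDl bformDl; congr (_ + _).
set S := \sum_i _ *m r i.
have -> : (1%:M - Q) *m S *m (1%:M - Q^T) *m A *m u
    = (1%:M - Q) *m (S *m A *m res u).
  have AQ : (1%:M - Q^T) *m A = A *m (1%:M - Q).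
    rewrite mulmxBl mulmxBr mul1mx mulmx1 /P0t !trmx_mul trmxK.
    by rewrite trmx_invmx_sym ?pA.1 ?pF.1 // !mulmxA.
  rewrite -!mulmxA (mulmxA (1%:M - Q^T)) AQ -!mulmxA; congr (_ *m (_ *m (_ *m _))).
  by rewrite mulmxBl mul1mx /P0t !mulmxA.
have -> : bform A ((1%:M - Q) *m (S *m A *m res u)) u = bform A (S *m A *m res u) (res u).
  rewrite mulmxBl mul1mx; move: (S *m A *m _) => w.
  by rewrite !bformE P0t_selfadjoint.
rewrite /S !mulmx_suml bform_suml; apply: eq_bigr => i _.
by rewrite bformC ?pA.1 // /bform dotC -!mulmxA dot_mulmxl trmxK !mulmxA.
Qed.

Lemma schwarz_upper u :
  bform A (schwarz_mx *m A *m u) u <= cR k lp eps * bform A u u.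
Proof.
rewrite schwarz_energy.
have h1 := bform_P0t_le u; rewrite -bform_P0t_exact in h1.
have h2 := residual_norm_le u; have h3 := local_solves_le pA pB hk (res u).
have h4 := (spsd_spd pA).2 (u - P *m u); have h5 := (spsd_spd pA).2 (P *m u).
have h6 := exact_pythagoras u.
have lp0 : 0 < lp by exact: lt_le_trans lmp.
have K0 : 0 <= k%:R :> R by rewrite ler0n.
(* [cR] is the larger root of [x^2 - (k (1 + eps^2) + lp) x + k lp], which is
   nonpositive both at [k] and at [lp + k eps^2] *)
have [c1 c2] : k%:R <= cR k lp eps /\ lp + k%:R * eps ^+ 2 <= cR k lp eps.
  rewrite /cR; move: (k%:R : R) K0 => K K0; set s := Num.sqrt _.
  (* Either sign of the absolute value yields one of the two inequalities; the radicand exceeds the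
     square by [4 K^2 eps^2]. *)
  have : `|K - lp - K * eps ^+ 2| <= s.
    rewrite -sqrtr_sqr; apply: ler_wsqrtr; rewrite -subr_ge0.
    have -> : (K * (1 + eps ^+ 2) - lp) ^+ 2 + 4%:R * lp * K * eps ^+ 2
      - (K - lp - K * eps ^+ 2) ^+ 2 = 4%:R * K * (K * eps ^+ 2) by ring.
    by apply: mulr_ge0; apply: mulr_ge0; rewrite ?sqr_ge0.
  rewrite ler_norml => /andP[a b]; split; lra.
have h7 : k%:R * bform A (res u) (res u) <= k%:R * (bform A (u - P *m u) (u - P *m u) +
     eps ^+ 2 * bform A (P *m u) (P *m u)) by rewrite ler_wpM2l.
rewrite -h6; nra.
Qed.

(** Pairing [u] with its own decomposition gives one duality product per component. Young's
    inequality with the common weight [s] separates the preconditioner energy from the cost of the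
    decomposition. *)
Lemma schwarz_lower_decomp s u c (w : forall i, 'cV[R]_(d i)) : 0 < s ->
  u = Z *m c + res (\sum_i (r i)^T *m w i) ->
  2 * bform A u u <= s * bform A (schwarz_mx *m A *m u) u
    + s^-1 * (bform F c c + \sum_i bform (B i) (w i) (w i)).
Proof.
move=> s0 uE; rewrite schwarz_energy bform_P0t.
have -> : bform A u u = dot c (Z^T *m A *m u) + \sum_i dot (w i) (r i *m A *m res u).
  rewrite {2}uE bformDr; congr (_ + _).
    by rewrite /bform dotC dot_mulmxl mulmxA.
  have -> W : bform A u (res W) = bform A (res u) W.
    by rewrite !bformE P0t_selfadjoint.
  rewrite bform_sumr; apply: eq_bigr => i _.
  by rewrite /bform dotC dot_mulmxl trmxK !mulmxA.
have := young_spd_scaled c (Z^T *m A *m u) pF s0.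
have : 2 * (\sum_i dot (w i) (r i *m A *m res u)) <=
  s^-1 * \sum_i bform (B i) (w i) (w i) +
  s * \sum_i bform (invmx (B i)) (r i *m A *m res u) (r i *m A *m res u).
  by rewrite !mulr_sumr -big_split; apply: ler_sum => i _; exact: young_spd_scaled.
rewrite !mulrDr; lra.
Qed.

Lemma schwarz_lower k1 tau u c (w : forall i, 'cV[R]_(d i)) : 0 <= tau ->
  u - \sum_i (r i)^T *m w i = Z *m c ->
  \sum_i bform (B i) (w i) (w i) <= k1%:R * tau * bform A u u ->
  cT k k1 tau lm eps * bform A u u <= bform A (schwarz_mx *m A *m u) u.
Proof.
move=> tau0; set W := \sum_i _ => uW hw.
set a := bform A u u.
have a0 : 0 <= a by exact: (spsd_spd pA).2.
have e0 : 0 <= eps by apply: le_trans eps_lm.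
set th := Num.sqrt (k%:R * k1%:R * tau).
have thE : th ^+ 2 = k%:R * k1%:R * tau by rewrite sqr_sqrtr // !mulr_ge0.
have g0 : 0 <= eps * th by rewrite mulr_ge0 // sqrtr_ge0.
(* The added term represents [Q *m W] in coarse coordinates, which offsets the correction in
   [res W]. *)
pose c' := c + invmx F *m (Z^T *m A *m W).
have Zc' : Z *m c' = P *m u + - ((P - Q) *m W).
  rewrite mulmxDr -(P0t_exact_range c) -uW mulmxBr mulmxBl /P0t !mulmxA.
  by rewrite opprB addrAC addrA.
have uE : u = Z *m c' + res W.
  by rewrite mulmxDr -uW /P0t !mulmxA -addrA subrKC subrK.
have WW : bform A W W <= th ^+ 2 * a.
  apply: le_trans (overlap_norm_le pA pB hk w) _.
  by rewrite thE -!mulrA ler_wpM2l // mulrA.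
(* The factor [lm^-1] passes from [F] to the exact coarse energy of [c'], which is the energy of
   [Z *m c']; the triangle inequality combines [P *m u] with an error of relative size
   [eps * th]. *)
have hc : bform F c' c' <= lm^-1 * ((1 + eps * th) ^+ 2 * a).
  rewrite ler_pdivlMl // (le_trans (hlm c')) // /coarse_mx -bform_mulmx Zc'.
  apply: spsd_add_le => //.
    by rewrite /a -(exact_pythagoras u) lerDr; exact: (spsd_spd pA).2.
  rewrite bformNl bformNr opprK (le_trans (coarse_error_le W)) //.
  rewrite exprMn -[leRHS]mulrA ler_wpM2l ?sqr_ge0 // (le_trans _ WW) //.
  by rewrite -(exact_pythagoras W) lerDr; exact: (spsd_spd pA).2.
set den := (1 + eps * th) ^+ 2 + lm * k1%:R * tau.
have den0 : 0 < den.
  rewrite ltr_pwDl //; first by rewrite exprn_gt0 // ltr_pwDl.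
  by rewrite !mulr_ge0 // ltW.
have cTE : cT k k1 tau lm eps = lm / den by [].
have cT0 : 0 < lm / den by rewrite divr_gt0.
have sV : 0 < (lm / den)^-1 by rewrite invr_gt0.
(* With weight [1 / cT], the decomposition cost is at most [a], half of the left side. *)
have := schwarz_lower_decomp sV uE; rewrite -/a invrK cTE.
set e := bform A _ u => H.
have H2 : lm / den * (bform F c' c' + \sum_i bform (B i) (w i) (w i)) <= a.
  apply: (@le_trans _ _ (lm / den * (lm^-1 * ((1 + eps * th) ^+ 2 * a) + k1%:R * tau * a))).
    by rewrite ler_pM2l // lerD.
  rewrite le_eqVlt; apply/orP; left; apply/eqP; rewrite /den.
  by field; rewrite -/den !gt_eqF.
by rewrite -ler_pdivlMl //; lra.
Qed.

End CoarseCorrection.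
End Schwarz.

(** * The GenEO splitting on the finite element subdomains *)

Section GenEO.
Variables (R : realType) (n N : nat).
Variables (T : finType) (edof : T -> {set 'I_n}) (Omega : 'I_N -> {set T}).

Local Notation r := (Rm R edof Omega).

Lemma restr_mxK (I : {set 'I_n}) : restr_mx R I *m (restr_mx R I)^T = 1%:M.
Proof.
apply/matrixP => i j; rewrite !mxE (bigD1 (enum_val i)) //= big1 => [|l li].
  by rewrite !mxE eqxx mul1r addr0 (inj_eq enum_val_inj) eq_sym.
by rewrite !mxE eq_sym (negbTE li) mul0r.
Qed.

Lemma Bm_spd (A : 'M[R]_n) i : is_spd A -> is_spd (Bm A edof Omega i).
Proof.
move=> pA; rewrite /Bm -{1}(trmxK (r i)); apply: spd_congruence => // c rc.
by rewrite -(mul1mx c) -(restr_mxK (subdofs edof (Omega i))) -mulmxA rc mulmx0.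
Qed.

Lemma card_coupled_le_k0 (A : 'M[R]_n) i :
  (#|[set j | r j *m A *m (r i)^T != 0%R]| <= k0 A edof Omega)%N.
Proof.
by rewrite /k0; exact: (leq_bigmax (F := fun i => #|[set j | r j *m A *m (r i)^T != 0%R]|)).
Qed.

(** After exchanging the sums, each element is counted once per subdomain containing it. *)
Lemma sum_subdomains_le_k1 (f : T -> R) : (forall K, 0 <= f K) ->
  \sum_i \sum_(K in Omega i) f K <= (k1 Omega)%:R * \sum_K f K.
Proof.
move=> f0; rewrite (exchange_big_dep predT) //= mulr_sumr; apply: ler_sum => K _.
rewrite sumr_const -[f K *+ _]mulr_natl ler_wpM2r // ler_nat.
apply: leq_trans (leq_bigmax (F := fun K => #|[set i | K \in Omega i]|) K).
by rewrite cardsE.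
Qed.

Lemma trmx_diag d (M : 'M[R]_d) : is_diag_mx M -> M^T = M.
Proof. by case/diag_mxP => v ->; rewrite tr_diag_mx. Qed.

Lemma mem_mximg p q (M : 'M[R]_(p, q)) (S : {vspace 'cV[R]_q}) u :
  u \in S -> M *m u \in mximg M S.
Proof.
move=> uS; have -> : M *m u = linfun (mulmx M : 'cV[R]_q -> 'cV[R]_p) u.
  by rewrite lfunE.
exact: memv_img.
Qed.

Variables (A : 'M[R]_n) (D : forall i, 'M[R]_(ndofs edof Omega i)).
Variable xi : forall i, 'M[R]_(ndofs edof Omega i).
Hypothesis pA : is_spd A.
Hypothesis dD : forall i, is_diag_mx (D i).

(** Congruence form: the GenEO matrix measures the [Bm] energy of [D i *m (1%:M - xi i) *m w]. *)
Lemma geneo_mxE i : geneo_mx A D xi i =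
  (D i *m (1%:M - xi i))^T *m Bm A edof Omega i *m (D i *m (1%:M - xi i)).
Proof.
by rewrite trmx_mul (trmx_diag (dD i)) linearB /= trmx1 /geneo_mx /Bm !mulmxA.
Qed.

Lemma geneo_mx_sym i : (geneo_mx A D xi i)^T = geneo_mx A D xi i.
Proof.
rewrite geneo_mxE; move: (Bm _ _ _ _) (Bm_spd i pA).1 (D i *m _) => B sB L.
by rewrite !trmx_mul trmxK sB mulmxA.
Qed.

Hypothesis hD : \sum_i (r i)^T *m D i *m r i = 1%:M.
Variable ANeu : forall i, 'M[R]_(ndofs edof Omega i).
Hypothesis pANeu : forall i, is_spd (ANeu i).
Variable G : {vspace 'cV[R]_n}.
Hypothesis hxi : forall i (u : 'cV[R]_(ndofs edof Omega i)),
  xi i *m u \in Gloc edof Omega G i.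
Variable v : forall j, 'I_(ndofs edof Omega j) -> 'cV[R]_(ndofs edof Omega j).
Variable lam : forall j, 'I_(ndofs edof Omega j) -> R.
Hypothesis hv : forall j, is_geneo_eigenbasis A D xi (ANeu j) (@v j) (@lam j).

Lemma geneo_decomposition tau u : 0 <= tau ->
  exists2 w : forall i, 'cV[R]_(ndofs edof Omega i),
    u - \sum_i (r i)^T *m w i \in (VG D G + Vgeneo D xi v lam tau)%VS &
    \sum_i bform (Bm A edof Omega i) (w i) (w i)
      <= tau * \sum_i bform (ANeu i) (r i *m u) (r i *m u).
Proof.
move=> tau0.
have split_i i := pencil_low_high (geneo_mx_sym i) (spsd_spd (pANeu i)) tau0
  (hv i).1 (hv i).2 (r i *m u).
pose w i := sval (cid (split_i i)).
have hw i : exists c, r i *m u = w i + \sum_(k | tau < lam k) c k *: v k /\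
    bform (geneo_mx A D xi i) (w i) (w i) <= tau * bform (ANeu i) (r i *m u) (r i *m u).
  by rewrite /w; case: (cid (split_i i)).
exists (fun i => D i *m (1%:M - xi i) *m w i).
  (* Here [w i] is the low part of [r i *m u]. By the partition of unity, the remainder consists of
     projected parts, lying in [VG], and of high modes, lying in [Vgeneo]. *)
  have -> : u - \sum_i (r i)^T *m (D i *m (1%:M - xi i) *m w i) =
      \sum_i (r i)^T *m D i *m (xi i *m (r i *m u)) +
      \sum_i (r i)^T *m D i *m (1%:M - xi i) *m (r i *m u - w i).
    rewrite -{1}(mul1mx u) -hD mulmx_suml -sumrB -big_split.
    apply: eq_bigr => i _ /=.
    rewrite !mulmxA (mulmxBr _ _ (w i)) addrA !mulmxA; congr (_ - _).
    by rewrite mulmxBr mulmx1 !mulmxBl subrKC.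
  apply: memv_add; apply: memv_sumr => i _; first exact/mem_mximg/hxi.
  have [c [-> _]] := hw i; rewrite (addrAC (w i)) subrr add0r mulmx_sumr.
  by apply: memv_sumr => k hk; rewrite -scalemxAr memvZ // memv_line.
rewrite mulr_sumr; apply: ler_sum => i _; rewrite bform_mulmx -geneo_mxE.
by have [c [_]] := hw i.
Qed.

End GenEO.

(** * Assembly for the concrete coarse space *)

Lemma basis_col_inj (R : realType) n m (Z : 'M[R]_(n, m)) (V : {vspace 'cV[R]_n}) :
  basis_of V (codom (fun k => col k Z)) -> forall c : 'cV_m, Z *m c = 0 -> c = 0.
Proof.
move=> /andP[_ fr] c; have -> : c = \col_k c k 0.
  by apply/matrixP => i j; rewrite mxE ord1.
rewrite mulmx_sum_col => /(free_codom fr) c0.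
by apply/matrixP => i j; rewrite !mxE c0.
Qed.

Theorem mainTheorem2 (R : realType) (n N : nat)
  (* mesh elements, element forms and the global matrix *)
  (T : finType) (edof : T -> {set 'I_n}) (aK : T -> 'M[R]_n) (A : 'M[R]_n)
  (haK : forall K : T, is_spsd (aK K))
  (hA : A = \sum_(K : T) aK K)
  (hAspd : is_spd A)
  (* overlapping subdomains and partition of unity *)
  (Omega : 'I_N -> {set T})
  (hcover : \bigcup_(i < N) Omega i = [set: T])
  (D : forall i : 'I_N, 'M[R]_(ndofs edof Omega i))
  (hDdiag : forall i : 'I_N, is_diag_mx (D i))
  (hD : \sum_(i < N) (Rm R edof Omega i)^T *m D i *m Rm R edof Omega i = 1%:M)
  (* local Neumann matrices *)
  (ANeu : forall i : 'I_N, 'M[R]_(ndofs edof Omega i))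
  (hANeu : forall (i : 'I_N) (U V : 'cV[R]_n),
     bform (ANeu i) (Rm R edof Omega i *m U) (Rm R edof Omega i *m V)
     = \sum_(K in Omega i) bform (aK K) U V)
  (hANeuspd : forall i : 'I_N, is_spd (ANeu i))
  (* near-kernel and local projections *)
  (G : {vspace 'cV[R]_n})
  (xi : forall i : 'I_N, 'M[R]_(ndofs edof Omega i))
  (hxi : forall i : 'I_N,
     is_orth_proj (Bm A edof Omega i) (Gloc edof Omega G i) (xi i))
  (* GenEO eigenvectors and coarse space *)
  (v : forall j : 'I_N, 'I_(ndofs edof Omega j) -> 'cV[R]_(ndofs edof Omega j))
  (lam : forall j : 'I_N, 'I_(ndofs edof Omega j) -> R)
  (hv : forall j : 'I_N,
     is_geneo_eigenbasis A D xi (ANeu j) (v j) (lam j))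
  (tau : R) (htau : 0 < tau)
  (m : nat) (Z : 'M[R]_(n, m))
  (hZ : basis_of (VG D G + Vgeneo D xi v lam tau)%VS
          (codom (fun k : 'I_m => col k Z)))
  (* inexact coarse matrix *)
  (Et : 'M[R]_m) (hEt : is_spd Et)
  (lp lm : R)
  (hlp : is_lambda_max (coarse_mx A Z *m invmx Et) lp)
  (hlm : is_lambda_min (coarse_mx A Z *m invmx Et) lm)
  (epsA : R) (hepsA : epsA = Num.max `|1 - lm| `|1 - lp|) :
  forall U : 'cV[R]_n,
    cT (k0 A edof Omega) (k1 Omega) tau lm epsA * bform A U U
      <= bform A (MinvAS2 A edof Omega Z Et *m A *m U) U
    /\ bform A (MinvAS2 A edof Omega Z Et *m A *m U) U
      <= cR (k0 A edof Omega) lp epsA * bform A U U.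
Proof.
move=> U; set E := coarse_mx A Z.
have pE : is_spd E by apply: spd_congruence => //; exact: basis_col_inj hZ.
have lm0 : 0 < lm by apply: eigenvalue_spd_gt0 hlm.1.
have lmp : lm <= lp by apply: hlm.2 hlp.1.
have bp := lambda_max_pencil pE.1 hEt hlp.
have bm := lambda_min_pencil pE.1 hEt hlm.
have e1 : `|1 - lm| <= epsA by rewrite hepsA le_max lexx.
have e2 : `|1 - lp| <= epsA by rewrite hepsA le_max lexx orbT.
have pB i := Bm_spd edof Omega i hAspd.
have hk := card_coupled_le_k0 edof Omega A.
split; last exact: (schwarz_upper hAspd pE hEt lm0 bp bm lmp e1 e2 pB hk).
have [w] := geneo_decomposition hAspd hDdiag hD hANeuspd (fun i u => (hxi i u).1)
  hv U (ltW htau).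
rewrite -(span_basis hZ) => /mem_span_codom [c]; rewrite -mulmx_sum_col => Uw hw.
apply: (schwarz_lower hAspd pE hEt lm0 bp bm lmp e1 e2 pB hk (ltW htau) Uw).
apply: le_trans hw _.
(* Neumann energies are sums of element energies, so their total is at most [k1] times the global
   energy. *)
rewrite (mulrC _ tau) -mulrA ler_pM2l //.
under eq_bigr do rewrite hANeu.
have -> : bform A U U = \sum_K bform (aK K) U U by rewrite hA bform_mx_sum.
apply: (sum_subdomains_le_k1 Omega (f := fun K => bform (aK K) U U)) => K.
exact: (haK K).2.
Qed.
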